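(* For every positive integer $n$ divisible by $4$, there exist an $n$-dimensional acyclic unique sink orientation (AUSO) $\psi$ of the hypercube $Q^n$ and a starting vertex $v_0\in Q^n$ such that Johnson's least-recently basic rule (with ties broken by the fixed order $\prec$ described in the context), started at $v_0$, takes a path of length at least $2^{n/4}$ (i.e. makes at least $2^{n/4}$ steps) before reaching the global sink of $\psi$.
   Context: The $n$-dimensional hypercube $Q^n$ has vertex set $2^{[n]}$, with $u,v$ adjacent iff $|u\oplus v|=1$; the edge between $v$ and $v\oplus\{j\}$ is on coordinate $j$. A face is $F(C,v)=\{u: u\oplus v\subseteq C\}$. A unique sink orientation (USO) is an orientation of the edges of $Q^n$ such that every nonempty face has exactly one sink (vertex with no outgoing edges inside the face); an AUSO is an acyclic USO; the global sink is the unique vertex with no outgoing edges. A direction is a signed coordinate $\pm c$; at $v$, $+c$ refers to the edge to $v\cup\{c\}$ ($c\notin v$) and $-c$ to the edge to $v\setminus\{c\}$ ($c\in v$); it is available at $v$ if that edge exists and is outgoing from $v$. Johnson's least-recently basic rule: let $v_0,v_1,\dots,v_x$ be the vertices visited so far ($v_y$ is the vertex after step $y$). Before step $x+1$, define for each coordinate $c$: $h(+c)=\max(\{0\}\cup\{y\in\{1,\dots,x\}: c\in v_{y-1}\text{ or } c\in v_y\})$ and $h(-c)=\max(\{0\}\cup\{y\in\{1,\dots,x\}: c\notin v_{y-1}\text{ or } c\notin v_y\})$ (so $h(d)$ is the last step at which the coordinate was in the state that the opposite direction $-d$ leaves behind, i.e. the direction left the basis least recently). If $v_x$ is not the global sink,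 the rule moves along the available direction $d$ minimizing $h(d)$, breaking ties by the order $\prec$: writing $n=4m$ and grouping coordinates into bundles $\{4j+1,4j+2,4j+3,4j+4\}$ for $j=0,\dots,m-1$, directions of bundle $j$ precede those of bundle $j'$ whenever $j<j'$, and within bundle $j$ the order is $+(4j+1)\prec+(4j+2)\prec+(4j+3)\prec+(4j+4)\prec-(4j+1)\prec-(4j+2)\prec-(4j+3)\prec-(4j+4)$. *)

(* Defs.v *)
(* Coordinates are 0-indexed: 'I_n = {0,...,n-1} stands for
   the paper's [n] = {1,...,n} (coordinate c here is coordinate c+1 there). *)
From mathcomp Require Import all_boot.
Set Implicit Arguments. Unset Strict Implicit. Unset Printing Implicit Defensive.

Section Cube.
Variable n : nat.
Notation vtx := {set 'I_n}.

Definition symd (u v : vtx) : vtx := (u :\: v) :|: (v :\: u).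

Definition flip (v : vtx) (j : 'I_n) : vtx := symd v [set j].

(* An orientation of Q^n: [out v j] says that the edge on coordinate j
   at v (between v and flip v j) is oriented away from v. *)
Definition orientation (out : vtx -> 'I_n -> bool) : Prop :=
  forall v j, out (flip v j) j = ~~ out v j.

Definition face (C v : vtx) : pred vtx := fun u => symd u v \subset C.

Definition sink_in (out : vtx -> 'I_n -> bool) (C u : vtx) : bool :=
  [forall j in C, ~~ out u j].

Definition USO (out : vtx -> 'I_n -> bool) : Prop :=
  orientation out /\
  forall C v : vtx, #|[set u | face C v u & sink_in out C u]| = 1.

Definition arc (out : vtx -> 'I_n -> bool) : rel vtx :=
  fun u w => [exists j, (w == flip u j) && out u j].

Definition acyclic (out : vtx -> 'I_n -> bool) : Prop :=
  forall u w, arc out u w -> ~~ connect (arc out) w u.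

Definition AUSO out : Prop := USO out /\ acyclic out.

Definition global_sink (out : vtx -> 'I_n -> bool) (v : vtx) : bool :=
  [forall j, ~~ out v j].

Definition hist (s : seq vtx) (c : 'I_n) (plus : bool) : nat :=
  \max_(1 <= y < size s |
          if plus then (c \in nth set0 s y.-1) || (c \in nth set0 s y)
          else (c \notin nth set0 s y.-1) || (c \notin nth set0 s y)) y.

(* position of a direction in the tie-breaking order \prec:
   bundles {4j,..,4j+3} (0-indexed); within a bundle
   +(4j) < +(4j+1) < +(4j+2) < +(4j+3) < -(4j) < ... < -(4j+3). *)
Definition prec_key (c : 'I_n) (plus : bool) : nat :=
  8 * (c %/ 4) + (if plus then c %% 4 else 4 + c %% 4).

(* the direction available at v along coordinate c (if out v c) is +c iff c \notin v *)
Definition dir_sign (v : vtx) (c : 'I_n) : bool := c \notin v.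

Definition lrb_step (out : vtx -> 'I_n -> bool) (s : seq vtx) (w : vtx) : Prop :=
  let v := last set0 s in
  exists c : 'I_n,
    [/\ out v c, w = flip v c &
        forall c' : 'I_n, out v c' -> c' != c ->
          (hist s c (dir_sign v c) < hist s c' (dir_sign v c'))
          || ((hist s c (dir_sign v c) == hist s c' (dir_sign v c'))
              && (prec_key c (dir_sign v c) < prec_key c' (dir_sign v c')))].

Definition lrb_run (out : vtx -> 'I_n -> bool) (p : seq vtx) : Prop :=
  forall k, 0 < k < size p -> lrb_step out (take k p) (nth set0 p k).

End Cube.

(* Main.v *)
Require Import Defs.
From mathcomp Require Import all_boot.
From mathcomp Require Import zify.

(* At a vertex [v], the history [h(d)] of an available direction [d] is the last
   step that flipped its coordinate, so the rule flips the least recently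
   flipped outgoing coordinate.

   From an AUSO [A] with a long run one gets, with three more coordinates, an
   AUSO with a run more than twice as long. Over each vertex of [A], put a fibre
   AUSO on the new 3-cube, all fibres having the same sink [U]. The face over
   [U] is then a hypersink, in which [A] may be replaced by any AUSO [B]. While
   [A] runs, the new coordinates turn round the hexagon of the six vertices of
   the 3-cube other than [U] and its antipode, and each of them is flipped at
   most once per step of [A], because after that it is more recent than the
   coordinate that [A] wants to flip. A fibre may therefore break its hexagon
   at a vertex that is three moves ahead, and [U] is reached only once [A] is at
   its sink; then [B] runs. As [B] is chosen for the vertex and the flipping
   order with which [U] is reached, the history need not be reset.
   The fourth coordinate of each bundle stays idle. *)
Set Implicit Arguments. Unset Strict Implicit. Unset Printing Implicit Defensive.

(** * Flips, and AUSOs on a subset of the coordinates *)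

Section LeastRecentlyFlipped.
Variable n : nat.
Notation vtx := {set 'I_n}.
Notation orient := (vtx -> 'I_n -> bool).
Implicit Types (u v w : vtx) (D N : vtx) (A B P out : orient) (c d j : 'I_n).

Lemma in_symd u v j : (j \in symd u v) = (j \in u) (+) (j \in v).
Proof. by rewrite !inE; case: (j \in u); case: (j \in v). Qed.

Lemma in_flip v c j : (j \in flip v c) = (j \in v) (+) (j == c).
Proof. by rewrite in_symd inE. Qed.

Lemma symdC u v : symd u v = symd v u.
Proof. by apply/setP=> j; rewrite !in_symd addbC. Qed.

Lemma symd_flip v c : symd v (flip v c) = [set c].
Proof. by apply/setP=> j; rewrite in_symd in_flip addKb inE. Qed.

Lemma flipI v c D : c \in D -> flip v c :&: D = flip (v :&: D) c.
Proof.
move=> cD; apply/setP=> j; rewrite !(in_flip, inE).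
by case: (eqVneq j c) => [->|_]; rewrite ?cD ?andbT // !addbF.
Qed.

Lemma flipI_notin v c D : c \notin D -> flip v c :&: D = v :&: D.
Proof.
move=> cD; apply/setP=> j; rewrite !(in_flip, inE).
by case: eqP => [->|_]; rewrite ?(negPf cD) ?andbF ?addbF.
Qed.

(** Only edges on coordinates in [D] are constrained; the other coordinates act as parameters. The
    middle clause forbids two sinks in the face spanned by [u] and [w]. The rank [r] gives
    acyclicity and, through its minima, the existence of sinks. *)
Definition auso_on D out : Prop :=
  [/\ forall v j, j \in D -> out (flip v j) j = ~~ out v j,
      forall u w, symd u w \subset D ->
        (forall j, j \in symd u w -> ~~ out u j && ~~ out w j) -> u = w
    & exists r : vtx -> nat, forall v j,
        j \in D -> out v j -> r (flip v j) < r v].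

Definition local_on D out : Prop :=
  forall u w j, j \in D -> u :&: D = w :&: D -> out u j = out w j.

(** A vertex of least rank in a face is a sink there. A second sink would differ from it only in
    coordinates of [C], on which both are sinks. *)
Lemma auso_onT out : auso_on setT out -> AUSO out.
Proof.
case=> oout uniq_sink [r r_dec]; split; first split=> [v j|C v].
- exact: oout (in_setT j).
- have faceP u : face C v u = (symd u v \subset C) by [].
  have [|u uF u_min] := @arg_minnP _ v (face C v) r.
    by rewrite faceP; apply/subsetP=> j; rewrite in_symd addbb.
  have uS : sink_in out C u.
    apply/forall_inP=> j jC; apply/negP=> /(r_dec _ _ (in_setT j)).
    rewrite ltnNge u_min // faceP; apply/subsetP=> i.
    rewrite in_symd in_flip; case: eqP => [-> //|_]; rewrite addbF.
    by move: (subsetP uF i); rewrite in_symd.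
  apply/eqP/cards1P; exists u; apply/setP=> w; rewrite !inE.
  apply/andP/eqP=> [[wF wS]|-> //].
  apply: uniq_sink; first exact: subsetT.
  move=> j; rewrite in_symd => jwu.
  have jC : j \in C.
    move: (subsetP uF j) (subsetP wF j) jwu; rewrite !in_symd.
    by case: (j \in u); case: (j \in w); case: (j \in v);
      case: (j \in C) => //= H1 H2 _;
      (try exact: H1); exact: H2.
  by rewrite (forall_inP wS) // (forall_inP uS).
- move=> u w /existsP[j /andP[/eqP-> uj]].
  have arc_dec x y : Defs.arc out x y -> r y <= r x.
    by case/existsP=> i /andP[/eqP-> xi]; exact: ltnW (r_dec _ _ (in_setT i) xi).
  apply/negP=> /connectP[p pth uE]; have := r_dec _ _ (in_setT j) uj.
  rewrite ltnNge => /negP[]; rewrite {1}uE.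
  elim: p (flip u j) pth {uE} => //= x p IHp y /andP[yx xp].
  exact: leq_trans (IHp _ xp) (arc_dec _ _ yx).
Qed.

(** * Constructions: uniform orientations and hypersink reorientation *)

Lemma uniform_auso D w : auso_on D (fun v j => (j \in v) (+) (j \in w)).
Proof.
split=> [v j _|u v _ uv|].
- by rewrite in_flip eqxx addbT addNb.
- apply/setP=> j; move: (uv j); rewrite in_symd.
  by case: (j \in u); case: (j \in v); case: (j \in w) => //= /(_ isT).
- exists (fun v => #|symd v w|) => v j _ vw; apply: proper_card; apply/properP.
  split; last by exists j; rewrite !(in_flip, in_symd) ?eqxx ?addbT ?addNb ?vw.
  apply/subsetP=> i; rewrite !(in_flip, in_symd).
  by case: eqP => [->|_]; rewrite ?addbF.
Qed.

(* The vertices satisfying [H] form a hypersink of the product of [A] with the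
   fibres [P]; its [D]-edges may therefore be reoriented by an arbitrary [B]. *)
Definition glue N (H : pred vtx) A B P : orient :=
  fun v j => if j \in N then P v j else if H v then B v j else A v j.

(** Of two vertices violating sink uniqueness, both or neither lie in the hypersink. Inside it, [B]
    separates them. Outside, [A] sees only the [D]-part and forces these parts to agree, so both
    vertices lie in one fibre, where [P] applies. *)
Lemma glue_auso D N (H : pred vtx) A B P :
  [disjoint D & N] -> auso_on D A -> local_on D A -> auso_on D B ->
  auso_on N P -> (forall u w, u :&: N = w :&: N -> H u = H w) ->
  (forall v j, H v -> j \in N -> ~~ P v j) ->
  auso_on (D :|: N) (glue N H A B P).
Proof.
move=> dDN [oA uA [rA decA]] locA [oB uB [rB decB]] [oP uP [rP decP]] locH HP.
have ND j : j \in D -> j \notin N by move=> jD; rewrite (disjointFr dDN).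
have DN j : j \in N -> j \notin D by move=> jN; rewrite (disjointFl dDN).
have Hflip v j : j \in D -> H (flip v j) = H v.
  by move=> jD; apply: locH; rewrite flipI_notin ?ND.
split.
- move=> v j; rewrite /glue in_setU; case: ifP => [jN _|_]; first exact: oP.
  rewrite orbF => jD; rewrite Hflip //.
  by case: (H v); [exact: oB | exact: oA].
- move=> u w uwS uw_sink.
  have uwD j : j \in D -> j \in symd u w ->
      if H u then ~~ B u j else ~~ A u j.
    by move=> jD /uw_sink/andP[]; rewrite /glue (negPf (ND _ jD)); case: (H u).
  pose mix x y : vtx := (y :&: D) :|: (x :\: D).
  have mixN x y : mix x y :&: N = x :&: N.
    apply/setP=> j; rewrite !inE; case jN: (j \in N); last by rewrite !andbF.
    by rewrite (negPf (DN _ jN)) andbF.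
  have mixD x y : mix x y :&: D = y :&: D.
    by apply/setP=> j; rewrite !inE; case: (j \in D); rewrite ?andbF ?andbT ?orbF.
  (* Moving [x] within its [D]-face to the fibre of [y] keeps it in [H], hence a sink of that fibre;
     uniqueness for [P] identifies it with [y]. *)
  have key x y : symd x y \subset D :|: N ->
      (forall j, j \in symd x y -> ~~ glue N H A B P y j) ->
      H x -> symd x y \subset D.
    move=> xyS y_sink Hx.
    have mxy : symd (mix x y) y \subset N.
      apply/subsetP=> j; move: (subsetP xyS j); rewrite !(in_flip, in_symd, inE).
      by case: (j \in D); case: (j \in x); case: (j \in y);
        case: (j \in N) => //= /(_ isT).
    have -> : y = mix x y.
      apply/esym/uP=> // j jxy; have jN := subsetP mxy _ jxy.
      rewrite HP //=; last by rewrite (locH _ x).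
      have /y_sink : j \in symd x y.
        by move: jxy; rewrite !(in_flip, in_symd, inE) (negPf (DN _ jN)) andbF.
      by rewrite /glue jN.
    apply/subsetP=> j; rewrite !(in_flip, in_symd, inE).
    by case: (j \in D); case: (j \in x); case: (j \in y).
  have [Hu|Hu] := boolP (H u).
    have uwsD : symd u w \subset D.
      by apply: key => // j /uw_sink/andP[].
    have Hw : H w.
      rewrite (locH w u) //; apply/setP=> j; rewrite !inE.
      case jN: (j \in N); rewrite ?andbF ?andbT //.
      move: (subsetP uwsD j); rewrite in_symd (negPf (DN _ jN)).
      by case: (j \in u); case: (j \in w) => // /(_ isT).
    apply: uB => // j jX; have jN := ND _ (subsetP uwsD _ jX).
    by have := uw_sink _ jX; rewrite /glue (negPf jN) Hu Hw.
  have [Hw|Hw] := boolP (H w).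
    have uwsD : symd w u \subset D.
      by apply: key => //; rewrite symdC // => j /uw_sink/andP[].
    case/negP: Hu; rewrite (locH u w) //; apply/setP=> j; rewrite !inE.
    case jN: (j \in N); rewrite ?andbF ?andbT //.
    move: (subsetP uwsD j); rewrite in_symd (negPf (DN _ jN)).
    by case: (j \in u); case: (j \in w) => // /(_ isT).
  have um : symd u (mix u w) \subset D.
    apply/subsetP=> j; rewrite !(in_flip, in_symd, inE).
    by case: (j \in D); case: (j \in u); case: (j \in w).
  have uE : u = mix u w.
    apply: uA => // j jX; have jD := subsetP um _ jX.
    have jXuw : j \in symd u w.
      by move: jX; rewrite !(in_flip, in_symd, inE) jD /= andbT orbF.
    rewrite (locA (mix u w) w) ?mixD //.
    by have := uw_sink _ jXuw; rewrite /glue (negPf (ND _ jD)) (negPf Hu) (negPf Hw).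
  have uwN : symd u w \subset N.
    apply/subsetP=> j jX; have := subsetP uwS _ jX; rewrite in_setU.
    case/orP=> [jD|//]; move: jX; rewrite uE !(in_symd, inE) jD /= andbT orbF.
    by rewrite addbb.
  apply: uP => // j jX; have := uw_sink _ jX.
  by rewrite /glue (subsetP uwN _ jX).
- pose M := (\max_v rB v).+1; pose K := (\max_v rP v).+1.
  (* Everything off the hypersink ranks above everything in it. Off it the rank is lexicographic
     with [A] first, since a [D]-step may change the fibre and raise [rP]. *)
  exists (fun v => if H v then rB v else M + (rA (v :&: D) * K + rP v)) => v j.
  have ltM v' : rB v' < M by rewrite ltnS leq_bigmax.
  have ltK v' : rP v' < K by rewrite ltnS leq_bigmax.
  rewrite /glue in_setU; have [jN _ Pv|jN] := ifPn.
    have /negPf Hv : ~~ H v by apply/negP=> /HP/(_ jN); rewrite Pv.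
    rewrite Hv flipI_notin ?DN //; case: ifP => _.
      exact: leq_trans (ltM _) (leq_addr _ _).
    by rewrite !ltn_add2l decP.
  rewrite orbF => jD; rewrite Hflip //; case: (H v) => out_j; first exact: decB.
  rewrite ltn_add2l flipI // -flipI // flipI //.
  have rlt : rA (flip (v :&: D) j) < rA (v :&: D).
    by apply: decA => //; rewrite (locA _ v) // -setIA setIid.
  apply: (@leq_trans ((rA (flip (v :&: D) j)).+1 * K)).
    by rewrite mulSn addnC ltn_add2r.
  by apply: leq_trans (leq_addr _ _); rewrite leq_mul2r rlt orbT.
Qed.

Lemma eq_setIS D N u w : D \subset N -> u :&: N = w :&: N -> u :&: D = w :&: D.
Proof. by move=> /setIidPr <-; rewrite !setIA => ->. Qed.

Lemma glue_local D N (H : pred vtx) A B P :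
  local_on D A -> local_on D B ->
  (forall u w, u :&: N = w :&: N -> H u = H w) ->
  local_on (D :|: N) P -> local_on (D :|: N) (glue N H A B P).
Proof.
move=> locA locB locH locP u w j jDN uw; rewrite /glue.
have uwN := eq_setIS (subsetUr D N) uw.
have uwD := eq_setIS (subsetUl D N) uw.
case: ifP => [jN|jN]; first exact: locP.
have jD : j \in D by move: jDN; rewrite in_setU jN orbF.
by rewrite (locH u w) //; case: (H w); [exact: locB | exact: locA].
Qed.

(** * Runs driven by a recency order *)

(* In the state [(v, R)] of a run, [R c d] means that [c] was flipped less
   recently than [d]. *)
Notation state := (vtx * rel 'I_n)%type.

Definition priority (R : rel 'I_n) : Prop :=
  (forall c d, c != d -> R c d || R d c) /\ transitive R.

Definition demote c (R : rel 'I_n) : rel 'I_n :=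
  fun x y => (x != c) && ((y == c) || R x y).

Lemma demote_priority c R : priority R -> priority (demote c R).
Proof.
case=> totR trR; split=> [x y xy|y x z]; rewrite /demote.
  have [xc|xc] := eqVneq x c; have [yc|yc] := eqVneq y c => //=.
  - by rewrite xc yc eqxx in xy.
  - exact: totR.
case/andP=> xc /orP[/eqP->|Rxy]; first by rewrite eqxx.
by case/andP=> yc /orP[->|Ryz]; rewrite xc ?(trR _ _ _ Rxy Ryz) ?orbT.
Qed.

Lemma demoteE c R x y : x != c -> y != c -> demote c R x y = R x y.
Proof. by rewrite /demote => -> /negPf->. Qed.

Lemma demote_last c R x : x != c -> demote c R x c.
Proof. by rewrite /demote eqxx => ->. Qed.

Definition step out D (x y : state) : Prop :=
  exists2 c, [/\ c \in D, out x.1 c &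
                 forall d, d \in D -> out x.1 d -> d != c -> x.2 c d]
           & y = (flip x.1 c, demote c x.2).

Fixpoint run out D k (x y : state) : Prop :=
  if k is k'.+1 then exists2 z, step out D x z & run out D k' z y else x = y.

Lemma run_cat out D k l x y z :
  run out D k x y -> run out D l y z -> run out D (k + l) x z.
Proof.
elim: k x => [|k IHk] x /= => [-> //|[t xt ty] yz].
by exists t; last exact: IHk yz.
Qed.

Lemma run_priority out D k x y : run out D k x y -> priority x.2 -> priority y.2.
Proof.
elim: k x => [|k IHk] x /= => [-> //|[t [c _ ->] /IHk]].
by move=> IH /(demote_priority c).
Qed.

(** * The fibre AUSOs on three coordinates *)

Notation triple := ('I_n * 'I_n * 'I_n)%type.

Definition enumerates N (t : triple) : bool :=
  let: (x, y, z) := t in [&& x != y, x != z, y != z & N == [set x; y; z]].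

Lemma enumerates_rot N x y z : enumerates N (x, y, z) -> enumerates N (y, z, x).
Proof.
case/and4P=> xy xz yz /eqP->; rewrite /enumerates yz ![_ == x]eq_sym xy xz /=.
by apply/eqP/setP=> j; rewrite !inE; case: (j == x); case: (j == y); case: (j == z).
Qed.

(* Relative to the sink [U], this fibre orients the hexagon of the 3-cube as
   {y} <- {x,y} -> {x} -> {x,z} -> {z} -> {y,z} -> {y}: it is the cyclic unique
   sink orientation with the edge from {y} to {x,y} reversed. *)
Definition fiber U (t : triple) : orient := fun v j =>
  let: (x, y, z) := t in let s := symd v U in
  if j == x then x \in s
  else if j == z then (z \in s) (+) (x \in s)
  else (y \in s) (+) ((z \in s) && (x \notin s)).

(** The fibre is triangular: the edge on [x] depends on [x] alone, the edge on [z] on [x] and [z],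
    the edge on [y] on all three. So two sinks agree on [x], then on [z], then on [y]. *)
Lemma fiber_auso D N U (E : vtx -> triple) :
  [disjoint D & N] -> (forall w, enumerates N (E w)) ->
  auso_on N (fun v => fiber U (E (v :&: D)) v).
Proof.
move=> dDN EN.
have DN j : j \in N -> j \notin D by move=> jN; rewrite (disjointFl dDN).
split.
- move=> v j jN; rewrite flipI_notin ?DN //.
  have := EN (v :&: D); case: (E _) => [[x y] z] /and4P[xy xz yz /eqP NE].
  move: jN; rewrite NE !inE -orbA /fiber !(in_flip, in_symd).
  case/or3P=> /eqP->; rewrite !eqxx ?(negPf xy) ?(negPf xz) ?(negPf yz) //;
  rewrite ?[y == x]eq_sym ?[z == x]eq_sym ?[z == y]eq_sym;
  rewrite ?(negPf xy) ?(negPf xz) ?(negPf yz);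
  by case: (x \in v); case: (y \in v); case: (z \in v);
     case: (x \in U); case: (y \in U); case: (z \in U).
- move=> u w uwN uw_sink.
  have uwD : u :&: D = w :&: D.
    apply/setP=> j; rewrite !inE; case jD: (j \in D); rewrite ?andbF ?andbT //.
    move: (subsetP uwN j); rewrite in_symd (disjointFr dDN jD).
    by case: (j \in u); case: (j \in w) => // /(_ isT).
  move: uw_sink; rewrite uwD; have := EN (w :&: D).
  case: (E _) => [[x y] z] /and4P[xy xz yz /eqP NE] uw_sink.
  have eqx : (x \in u) = (x \in w).
    move: (uw_sink x); rewrite /fiber eqxx !in_symd.
    by case: (x \in u); case: (x \in w); case: (x \in U) => // /(_ isT).
  have eqz : (z \in u) = (z \in w).
    move: (uw_sink z); rewrite /fiber eqxx eq_sym (negPf xz) !in_symd eqx.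
    by case: (z \in u); case: (z \in w); case: (z \in U);
      case: (x \in w); case: (x \in U) => // /(_ isT).
  have eqy : (y \in u) = (y \in w).
    move: (uw_sink y); rewrite /fiber eq_sym (negPf xy) (negPf yz) !in_symd eqx eqz.
    case: ((z \in w) (+) _); case: ((x \in w) (+) _);
    by case: (y \in u); case: (y \in w); case: (y \in U) => // /(_ isT).
  apply/setP=> j; apply/eqP; rewrite -[_ == _]negbK negb_eqb -in_symd.
  apply/negP=> jX; have := subsetP uwN _ jX; rewrite NE !inE -orbA.
  move: jX; rewrite in_symd => + /or3P[] /eqP jE.
  - by rewrite jE eqx addbb.
  - by rewrite jE eqy addbb.
  - by rewrite jE eqz addbb.
(* Binary weights in the triangular order: flipping an outgoing coordinate changes only bits of
   lower weight besides its own. *)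
- pose r t v := let: (x, y, z) := t in
    4 * fiber U t v x + 2 * fiber U t v z + fiber U t v y.
  exists (fun v => r (E (v :&: D)) v) => v j jN; rewrite flipI_notin ?DN //.
  have := EN (v :&: D); case: (E _) => [[x y] z] /and4P[xy xz yz /eqP NE].
  move: jN; rewrite NE !inE -orbA; case/or3P=> /eqP->;
  rewrite /r /fiber !eqxx ?[y == x]eq_sym ?[z == x]eq_sym;
  rewrite (negPf xy) (negPf xz) (negPf yz) !(in_flip, in_symd) !eqxx;
  rewrite ?[y == x]eq_sym ?[z == x]eq_sym ?[z == y]eq_sym;
  rewrite ?(negPf xy) ?(negPf xz) ?(negPf yz);
  by case: (x \in v); case: (y \in v); case: (z \in v);
     case: (x \in U); case: (y \in U); case: (z \in U).
Qed.

(** * Simulating a run of [A] in the product with the fibres *)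

Section Simulation.
Variables (D N U : vtx) (A : orient).
Hypothesis dDN : [disjoint D & N].
Hypothesis locA : local_on D A.

(* The fibre coordinates are on the hexagon, and the least recently flipped one
   is next in the cyclic order; [b] is the parity of the position. *)
Definition on_hexagon (b : bool) x y z v (R : rel 'I_n) : Prop :=
  [/\ enumerates N (x, y, z),
      [/\ (x \in symd v U) = b, (y \in symd v U) = ~~ b
        & (z \in symd v U) = b]
    & R x y /\ R y z].

(** The [D]-edges over [U] are left free, so that simulated runs are the same for every orientation
    put into the hypersink later. *)
Definition extends (t : triple) v out : Prop := forall w, w :&: D = v :&: D ->
  (forall j, j \in N -> out w j = fiber U t w j) /\
  (w :&: N != U :&: N -> forall j, j \in D -> out w j = A w j).

Lemma enumerates_mem x y z : enumerates N (x, y, z) ->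
  [/\ x \in N, y \in N & z \in N].
Proof. by case/and4P=> _ _ _ /eqP->; rewrite !inE !eqxx !orbT. Qed.

Lemma enumeratesE x y z j : enumerates N (x, y, z) -> j \in N ->
  [\/ j = x, j = y | j = z].
Proof.
by case/and4P=> _ _ _ /eqP->; rewrite !inE -orbA => /or3P[]/eqP->;
  [apply: Or31 | apply: Or32 | apply: Or33].
Qed.

Lemma notin_fiber j : j \in N -> j \notin D.
Proof. by move=> jN; rewrite (disjointFl dDN). Qed.

Lemma on_hexagon_neq b x y z v R : on_hexagon b x y z v R -> v :&: N != U :&: N.
Proof.
case=> xyzN [xs ys _] _; have [xN yN _] := enumerates_mem xyzN.
apply/eqP=> /setP vU; move: (vU x) (vU y) xs ys.
by rewrite !in_setI xN yN !andbT !in_symd => -> ->; rewrite !addbb => <-.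
Qed.

(** One move along the hexagon rotates the triple and toggles the parity. Whether [y] and [z] are
    outgoing does not matter, since [x] precedes both in [R]. *)
Lemma flip_fiber_step b x y z v (R : rel 'I_n) t w : priority R ->
    on_hexagon b x y z v R -> v :&: D = w :&: D -> fiber U t v x ->
    (forall d, d \in D -> A v d -> R x d) ->
  on_hexagon (~~ b) y z x (flip v x) (demote x R) /\
  forall out, extends t w out ->
    step out (D :|: N) (v, R) (flip v x, demote x R).
Proof.
move=> [_ trR] hex vw tx Rx; have vU := on_hexagon_neq hex.
case: hex => xyzN [xs ys zs] [Rxy Ryz]; have [xN yN zN] := enumerates_mem xyzN.
have [xy xz yz _] := and4P xyzN.
split.
  split; first exact: enumerates_rot.
    move: xs ys zs; rewrite !(in_flip, in_symd) eqxx ![_ == x]eq_sym.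
    by rewrite (negPf xy) (negPf xz) !addbF addbT addNb negbK => -> -> ->.
  split; last by rewrite demote_last // eq_sym.
  by rewrite demoteE // eq_sym.
move=> out /(_ _ vw)[outN outD]; exists x => //.
split=> [||d]; rewrite ?in_setU ?xN ?orbT //=.
  by rewrite outN.
case/orP=> [dD|dN].
  by rewrite outD // => Ad _; exact: Rx.
by case: (enumeratesE xyzN dN) => ->; rewrite ?eqxx // => _ _; exact: trR Rxy Ryz.
Qed.

Lemma flip_base_step b x y z v (R : rel 'I_n) t w c : priority R ->
    on_hexagon b x y z v R -> v :&: D = w :&: D -> c \in D -> A v c ->
    (forall d, d \in D -> A v d -> d != c -> R c d) -> R c x ->
  on_hexagon b x y z (flip v c) (demote c R) /\
  forall out, extends t w out ->
    step out (D :|: N) (v, R) (flip v c, demote c R).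
Proof.
move=> [_ trR] hex vw cD Ac Rc Rcx; have vU := on_hexagon_neq hex.
case: hex => xyzN [xs ys zs] [Rxy Ryz]; have [xN yN zN] := enumerates_mem xyzN.
have Nc j : j \in N -> j != c.
  by move=> /notin_fiber; apply: contraNneq => ->.
split.
  split=> //; last by rewrite !demoteE ?Nc.
  by move: xs ys zs; rewrite !(in_flip, in_symd) !(negPf (Nc _ _)) // !addbF.
move=> out /(_ _ vw)[_ outD]; exists c => //.
split=> [||d]; rewrite ?in_setU ?cD //=.
  by rewrite outD.
case/orP=> [dD|dN]; first by rewrite outD // => Ad; exact: Rc.
have Rcy := trR _ _ _ Rcx Rxy.
by case: (enumeratesE xyzN dN) => -> // _ _; exact: trR Rcy Ryz.
Qed.


Definition next_move out c v (R : rel 'I_n) : Prop :=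
  [/\ c \in D, out v c & forall d, d \in D -> out v d -> d != c -> R c d].

Definition simulates t w c v (R : rel 'I_n) : Prop :=
  exists k b xyz v' R',
  [/\ 0 < k, on_hexagon b xyz.1.1 xyz.1.2 xyz.2 v' R',
      v' :&: D = flip w c :&: D, {in D &, R' =2 demote c R}
    & forall out, extends t w out -> run out (D :|: N) k (v, R) (v', R')].

Lemma simulates_base b x y z t w c v R : priority R ->
  on_hexagon b x y z v R -> v :&: D = w :&: D -> next_move A c v R -> R c x ->
  simulates t w c v R.
Proof.
move=> prR hex vw [cD Ac Rc] Rcx.
have [hex' vstep] := flip_base_step t prR hex vw cD Ac Rc Rcx.
exists 1, b, (x, y, z), (flip v c), (demote c R); split=> //.
  by rewrite !flipI // vw.
by move=> out /vstep ?; exists (flip v c, demote c R).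
Qed.

(** Either [c] is less recent than [x] and moves at once, or [x] precedes all outgoing coordinates
    of [D] and is flipped; the last premise then continues from there. *)
Lemma simulates_flip b x y z t w c v R : priority R ->
  on_hexagon b x y z v R -> v :&: D = w :&: D -> next_move A c v R ->
  fiber U t v x ->
  (on_hexagon (~~ b) y z x (flip v x) (demote x R) ->
   flip v x :&: D = w :&: D -> next_move A c (flip v x) (demote x R) ->
   priority (demote x R) -> simulates t w c (flip v x) (demote x R)) ->
  simulates t w c v R.
Proof.
move=> prR hex vw nxt tx IH; have [cD Ac Rc] := nxt.
have [xyzN _ _] := hex; have [xN _ _] := enumerates_mem xyzN.
have neqD d : d \in D -> d != x.
  by move=> dD; apply: contraTneq dD => ->; exact: notin_fiber.
have [/(simulates_base _ prR hex vw nxt) //|Rxc] := boolP (R c x).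
have {}Rxc : R x c.
  by case: prR => tot _; move: (tot _ _ (neqD _ cD)); rewrite (negPf Rxc).
have Rx d : d \in D -> A v d -> R x d.
  move=> dD Ad; have [->//|dc] := eqVneq d c.
  by case: prR => _ tr; apply: tr Rxc _; exact: Rc.
have [hex' vstep] := flip_fiber_step prR hex vw tx Rx.
have vxD : flip v x :&: D = v :&: D by rewrite flipI_notin ?notin_fiber.
have Avx d : d \in D -> A (flip v x) d = A v d by move=> dD; exact: locA.
have nxt' : next_move A c (flip v x) (demote x R).
  split; rewrite ?Avx // => d dD; rewrite Avx // => Ad dc.
  by rewrite demoteE ?neqD //; exact: Rc.
case: (IH hex' (etrans vxD vw) nxt' (demote_priority _ prR)) =>
  k [b' [t' [v' [R']]]].
case=> k0 hex2 v'w R'E kstep; exists k.+1, b', t', v', R'; split=> //.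
  by move=> d e dD eD; rewrite R'E // /demote neqD // (negPf (neqD e eD)).
move=> out ext; exists (flip v x, demote x R); first exact: vstep ext.
exact: kstep.
Qed.

(** Relative to [U] the run is at {x,z}, and the fibre allows the moves to {z}, {y,z} and {y}. After
    these, [x], [y] and [z] are all more recent than [c], so [c] moves at {y} at the latest. *)
Lemma simulates_odd x y z w c v R : priority R ->
  on_hexagon true x y z v R -> v :&: D = w :&: D -> next_move A c v R ->
  simulates (x, y, z) w c v R.
Proof.
move=> prR hex vw nxt; have [xyzN [xs ys zs] _] := hex.
have [xN yN zN] := enumerates_mem xyzN; have [xy xz yz _] := and4P xyzN.
have [cD _ _] := nxt.
have cN j : j \in N -> c != j.
  by move=> /notin_fiber; apply: contraNneq => <-.
apply: (simulates_flip prR hex vw nxt); first by rewrite /fiber eqxx.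
move=> hex1 vw1 nxt1 pr1; have [_ [ys1 zs1 xs1] _] := hex1.
apply: (simulates_flip pr1 hex1 vw1 nxt1).
  by rewrite /fiber eq_sym (negPf xy) (negPf yz) ys1 zs1 xs1.
move=> hex2 vw2 nxt2 pr2; have [_ [zs2 xs2 ys2] _] := hex2.
apply: (simulates_flip pr2 hex2 vw2 nxt2).
  by rewrite /fiber eq_sym (negPf xz) eqxx zs2 xs2.
move=> hex3 vw3 nxt3 pr3; apply: (simulates_base _ pr3 hex3 vw3 nxt3).
by rewrite demoteE ?cN // demoteE ?cN // demote_last ?cN.
Qed.

(** At an even position the fibre is rotated so that one flip of [x] leads to the odd case for the
    same fibre. *)
Definition fiber_at (b : bool) x y z : triple :=
  if b then (x, y, z) else (y, z, x).

Lemma fiber_at_even x y z v R : on_hexagon false x y z v R ->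
  fiber U (fiber_at false x y z) v x.
Proof.
case=> /and4P[xy xz yz _] [xs ys zs] _.
by rewrite /fiber_at /fiber (negPf xy) eqxx xs ys.
Qed.

Lemma simulates_step b x y z w c v R : priority R ->
  on_hexagon b x y z v R -> v :&: D = w :&: D -> next_move A c v R ->
  simulates (fiber_at b x y z) w c v R.
Proof.
case: b => prR hex vw nxt; first exact: simulates_odd.
apply: (simulates_flip prR hex vw nxt); first exact: fiber_at_even hex.
by move=> hex1 vw1 nxt1 pr1; exact: simulates_odd.
Qed.

Definition lands t w v (R : rel 'I_n) : Prop := exists k v' R',
  [/\ 1 < k, v' :&: D = w :&: D, v' :&: N = U :&: N
    & forall out, extends t w out -> run out (D :|: N) k (v, R) (v', R')].

(** With [A] at its sink nothing interrupts the three hexagon moves to {y}. There [y] is the only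
    outgoing coordinate, and flipping it reaches [U]. *)
Lemma lands_odd x y z w v R : priority R ->
  on_hexagon true x y z v R -> v :&: D = w :&: D ->
  (forall d, d \in D -> ~~ A w d) -> lands (x, y, z) w v R.
Proof.
move=> pr0 hex0 vw0 Aw; have [xyzN [xs ys zs] _] := hex0.
have [xN yN zN] := enumerates_mem xyzN; have [xy xz yz _] := and4P xyzN.
have Au u (S : rel 'I_n) c : u :&: D = w :&: D ->
    forall d, d \in D -> A u d -> S c d.
  by move=> uw d dD; rewrite (locA dD uw) (negPf (Aw _ dD)).
have [|hex1 st1] := flip_fiber_step (t := (x, y, z)) pr0 hex0 vw0 _ (Au _ _ _ vw0).
  by rewrite /fiber eqxx.
have vw1 : flip v x :&: D = w :&: D by rewrite flipI_notin ?notin_fiber.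
have pr1 := demote_priority x pr0; have [_ [ys1 zs1 xs1] _] := hex1.
have [|hex2 st2] := flip_fiber_step (t := (x, y, z)) pr1 hex1 vw1 _ (Au _ _ _ vw1).
  by rewrite /fiber eq_sym (negPf xy) (negPf yz) ys1 zs1 xs1.
have vw2 : flip (flip v x) y :&: D = w :&: D by rewrite flipI_notin ?notin_fiber.
have pr2 := demote_priority y pr1; have [_ [zs2 xs2 ys2] _] := hex2.
have [|hex3 st3] := flip_fiber_step (t := (x, y, z)) pr2 hex2 vw2 _ (Au _ _ _ vw2).
  by rewrite /fiber eq_sym (negPf xz) eqxx zs2 xs2.
have vw3 : flip (flip (flip v x) y) z :&: D = w :&: D.
  by rewrite flipI_notin ?notin_fiber.
move: (flip (flip (flip v x) y) z) (demote z _) hex3 vw3 st3 => v3 R3 hex3 vw3 st3.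
have [_ [xs3 ys3 zs3] _] := hex3.
exists 4, (flip v3 y), (demote y R3); split=> //.
- by rewrite flipI_notin ?notin_fiber.
- apply/setP=> j; rewrite !in_setI; case jN: (j \in N); rewrite ?andbF ?andbT //.
  apply/eqP; rewrite -[_ == _]negbK negb_eqb -in_symd.
  case: (enumeratesE xyzN jN) => ->;
  by rewrite in_symd in_flip ?eqxx ?(negPf xy) 1?eq_sym ?(negPf yz)
             ?addbF ?addbT ?addNb -in_symd ?xs3 ?ys3 ?zs3.
- move=> out ext; exists (flip v x, demote x R); first exact: st1.
  exists (flip (flip v x) y, demote y (demote x R)); first exact: st2.
  exists (v3, R3); first exact: st3.
  exists (flip v3 y, demote y R3) => //.
  have [outN outD] := ext _ vw3.
  have fy : fiber U (x, y, z) v3 y.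
    by rewrite /fiber eq_sym (negPf xy) (negPf yz) xs3 ys3 zs3.
  exists y => //; split=> [||d]; rewrite ?in_setU ?yN ?orbT //=.
    by rewrite outN.
  case/orP=> [dD|dN].
    by rewrite outD ?(locA dD vw3) ?(negPf (Aw _ dD)) //; exact: on_hexagon_neq hex3.
  rewrite outN //; case: (enumeratesE xyzN dN) => ->; rewrite ?eqxx //.
    by rewrite /fiber eqxx xs3.
  by rewrite /fiber eqxx eq_sym (negPf xz) xs3 zs3.
Qed.

Lemma lands_sink b x y z w v R : priority R ->
  on_hexagon b x y z v R -> v :&: D = w :&: D ->
  (forall d, d \in D -> ~~ A w d) -> lands (fiber_at b x y z) w v R.
Proof.
case: b => prR hex vw Aw; first exact: lands_odd.
have [xyzN _ _] := hex; have [xN _ _] := enumerates_mem xyzN.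
have [|hex1 st1] :=
    flip_fiber_step (t := fiber_at false x y z) prR hex vw (fiber_at_even hex).
  by move=> d dD; rewrite (locA dD vw) (negPf (Aw _ dD)).
have vw1 : flip v x :&: D = w :&: D by rewrite flipI_notin ?notin_fiber.
have [k [v' [R' [k1 v'D v'N kst]]]] := lands_odd (demote_priority x prR) hex1 vw1 Aw.
exists k.+1, v', R'; split=> //; first exact: ltnW.
by move=> out ext; exists (flip v x, demote x R); [exact: st1 | exact: kst].
Qed.

Lemma enumerates_fiber_at b x y z :
  enumerates N (x, y, z) -> enumerates N (fiber_at b x y z).
Proof. by case: b => //; exact: enumerates_rot. Qed.

(** Each step of [A] costs at least one step and the landing at least two. The fibres are chosen
    along the run; [out] is constrained only at ranks up to that of the current vertex, so that
    earlier choices do not interfere. *)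
Lemma simulate (r : vtx -> nat) k v R w S :
    (forall u j, j \in D -> A u j -> r (flip u j) < r u) ->
    (forall d, d \in D -> ~~ A w d) -> run A D k (v, R) (w, S) ->
  forall b x y z v' R', priority R' -> on_hexagon b x y z v' R' ->
    v' :&: D = v :&: D -> {in D &, R' =2 R} ->
  exists E : vtx -> triple, (forall u, enumerates N (E u)) /\
  exists k' w' S', [/\ k.+2 <= k', w' :&: D = w :&: D, w' :&: N = U :&: N
    & forall out,
        (forall u, r (u :&: D) <= r (v :&: D) -> extends (E (u :&: D)) u out) ->
        run out (D :|: N) k' (v', R') (w', S')].
Proof.
move=> r_dec Aw; elim: k v R => [|k IHk] v R /=.
  case=> -> _ b x y z v' R' prR' hex vv' _.
  have [xyzN _ _] := hex.
  exists (fun=> fiber_at b x y z); split=> [_|]; first exact: enumerates_fiber_at.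
  have [k' [w' [S' [k'2 w'D w'N runk']]]] := lands_sink prR' hex vv' Aw.
  by exists k', w', S'; split=> // out ext; apply: runk'; exact: ext.
case=> _ [c [/= cD Ac Rc] ->] run_k b x y z v' R' prR' hex vv' RR'.
have [xyzN _ _] := hex.
have nxt : next_move A c v' R'.
  split=> //= [|d dD]; rewrite (locA _ vv') // => Ad dc.
  by rewrite RR' //; exact: Rc.
have [k1 [b1 [t1 [v1 [R1 [k1_gt0 hex1 v1D RR1 run_k1]]]]]] :=
  simulates_step prR' hex vv' nxt.
have rlt : r (flip v c :&: D) < r (v :&: D).
  rewrite flipI //; apply: r_dec => //.
  by rewrite (locA cD (w := v)) // -setIA setIid.
have RR1' : {in D &, R1 =2 demote c R}.
  by move=> d e dD eD; rewrite RR1 // /demote RR'.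
have prR1 : priority R1.
  (* Any extending orientation yields an actual run, along which being a priority is preserved. *)
  pose out u j := if j \in N then fiber U (fiber_at b x y z) u j else A u j.
  have ext : extends (fiber_at b x y z) v out.
    move=> u _; rewrite /out; split=> [j -> //|_ j jD].
    by rewrite (disjointFr dDN jD).
  exact: run_priority (run_k1 _ ext) prR'.
have [E1 [E1N [k2 [w' [S' [k2_ge w'D w'N run_k2]]]]]] :=
  IHk _ _ run_k _ _ _ _ _ _ prR1 hex1 v1D RR1'.
(* The rest of the run has smaller rank, so the fibre over the current vertex can be set
   independently of it. *)
exists (fun u => if r u < r (v :&: D) then E1 u else fiber_at b x y z).
split=> [u|]; first by case: ifP => // _; exact: enumerates_fiber_at.
exists (k1 + k2), w', S'; split=> //; first exact: (@leq_add 1 k.+2).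
move=> out ext; apply: run_cat (run_k1 out _) (run_k2 out _).
  by have := ext v (leqnn _); rewrite ltnn.
move=> u ru; have ru' := leq_ltn_trans ru rlt.
by have := ext u (ltnW ru'); rewrite ru'.
Qed.

End Simulation.

(** * The recursive construction *)

Lemma fiber_sink N U t v j : enumerates N t -> v :&: N = U :&: N ->
  j \in N -> ~~ fiber U t v j.
Proof.
case: t => [[x y] z] tN /setP vU jN.
have noX i : i \in N -> (i \in symd v U) = false.
  move=> iN; move: (vU i); rewrite !in_setI iN !andbT in_symd => ->.
  by rewrite addbb.
have [xN yN zN] := enumerates_mem tN.
by rewrite /fiber !noX //; case: ifP => //; case: ifP.
Qed.

Lemma fiber_local N U t u w j :
  enumerates N t -> u :&: N = w :&: N -> fiber U t u j = fiber U t w j.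
Proof.
case: t => [[x y] z] tN /setP uw; have [xN yN zN] := enumerates_mem tN.
have eqN i : i \in N -> (i \in symd u U) = (i \in symd w U).
  by move=> iN; move: (uw i); rewrite !in_setI iN !andbT !in_symd => ->.
by rewrite /fiber !eqN.
Qed.

Lemma sorted_triple D (R : rel 'I_n) : priority R -> 2 < #|D| ->
  exists x y z, [/\ x \in D, y \in D & z \in D] /\
    [/\ x != y, x != z, y != z, R x y & R y z].
Proof.
case=> totR trR /card_gt2P[x [y [z [[xD yD zD] [xy yz zx]]]]].
have yx : y != x by rewrite eq_sym.
have zy : z != y by rewrite eq_sym.
have xz : x != z by rewrite eq_sym.
case/orP: (totR _ _ xy) => Rxy; case/orP: (totR _ _ yz) => Ryz;
  case/orP: (totR _ _ zx) => Rzx.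
- by exists x, y, z.
- by exists x, y, z.
- by exists z, x, y.
- by exists x, z, y.
- by exists y, z, x.
- by exists y, x, z.
- by exists z, y, x.
- by exists z, y, x.
Qed.

Lemma hypersink_run D N U (H : pred vtx) A B P k v R w S :
    [disjoint D & N] -> (forall u, H u = (u :&: N == U :&: N)) ->
    (forall u j, H u -> j \in N -> ~~ P u j) -> H v ->
    run B D k (v, R) (w, S) ->
  run (glue N H A B P) (D :|: N) k (v, R) (w, S) /\ H w.
Proof.
move=> dDN HE HP; elim: k v R => [|k IHk] v R Hv /=; first by case=> <- <-.
case=> _ [c [/= cD Bc Rc] ->] run_k.
have Hc : H (flip v c) by rewrite HE flipI_notin -?HE // (disjointFr dDN).
have [run_k' Hw] := IHk _ _ Hc run_k.
split=> //; exists (flip v c, demote c R) => //; exists c => //=.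
rewrite in_setU cD /glue Hv (disjointFr dDN) //; split=> // d.
rewrite in_setU; case: ifP => [dN _|_].
  by rewrite (negPf (HP _ _ Hv dN)).
by rewrite orbF; exact: Rc.
Qed.

(** The vertex and the order are arbitrary and given first, so that the second copy can be built for
    the state in which the first one ends. *)
Lemma long_run m D v R : priority R -> 3 * m <= #|D| ->
  exists out, [/\ auso_on D out, local_on D out
    & exists k w S, [/\ 2 ^ m.+1 <= k.+2, run out D k (v, R) (w, S)
                      & forall d, d \in D -> ~~ out w d]].
Proof.
elim: m D v R => [|m IHm] D v R prR cardD.
  (* All remaining coordinates are oriented towards [v], which gives a run of length 0. *)
  exists (fun u j => (j \in u) (+) (j \in v)); split.
  - exact: uniform_auso.
  - move=> u w j jD /setP/(_ j); rewrite !inE jD !andbT => -> //.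
  - by exists 0, v, R; split=> // d _; rewrite addbb.
have [|x [y [z [[xD yD zD] [xy xz yz Rxy Ryz]]]]] := @sorted_triple D R prR.
  by apply: leq_trans cardD; rewrite mulnS.
(* With this [U] the start is {y} relative to [U], an even hexagon position. *)
pose N := [set x; y; z]; pose D0 := D :\: N; pose U := flip v y.
have dDN : [disjoint D0 & N] by rewrite disjoint_sym disjoints_subset setCD subsetUr.
have ND : N \subset D.
  by apply/subsetP=> j; rewrite !inE -orbA => /or3P[]/eqP->.
have DE : D0 :|: N = D by rewrite -[RHS](setID D N) (setIidPr ND) setUC.
have cardN : #|N| = 3.
  by rewrite /N setUC cardsU1 cards2 !inE xy negb_or ![z == _]eq_sym xz yz.
have cardD0 : 3 * m <= #|D0|.
  rewrite cardsD (setIidPr ND) cardN.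
  by rewrite leq_subRL ?(leq_trans _ cardD) ?mulnS // -mulnS.
have tN : enumerates N (x, y, z) by rewrite /enumerates xy xz yz eqxx.
have [A [autA locA [kA [wA [SA [kA_ge runA sinkA]]]]]] := IHm D0 v R prR cardD0.
have [_ _ [r r_dec]] := autA.
have hex : on_hexagon N U false x y z v R.
  split=> //; rewrite !symd_flip !in_set1.
  by rewrite eqxx (negPf xy) [z == y]eq_sym (negPf yz).
have [E [EN [k1 [w1 [S1 [k1_ge w1D w1N run1]]]]]] :=
  simulate dDN locA r_dec sinkA runA prR hex erefl (fun _ _ _ _ => erefl).
pose H u := u :&: N == U :&: N.
pose P u := fiber U (E (u :&: D0)) u.
have run_glue B : run (glue N H A B P) D k1 (v, R) (w1, S1).
  rewrite -DE; apply: run1 => u _ w wu.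
  split=> [j jN|wN j jD]; rewrite /glue; first by rewrite jN /P wu.
  by rewrite (disjointFr dDN) // /H (negPf wN).
have prS1 : priority S1 := run_priority (run_glue A) prR.
(* The state [(w1, S1)] was reached for every choice of [B], so [B] may depend on it. *)
have [B [autB locB [kB [wB [SB [kB_ge runB sinkB]]]]]] := IHm D0 w1 S1 prS1 cardD0.
have HP u j : H u -> j \in N -> ~~ P u j by move=> /eqP; exact: fiber_sink.
have locH u w : u :&: N = w :&: N -> H u = H w by rewrite /H => ->.
exists (glue N H A B P); rewrite -{1 2}DE; split.
- by apply: glue_auso => //; exact: fiber_auso.
- apply: glue_local => // u w j _ uw; rewrite /P.
  rewrite (eq_setIS (subsetUl D0 N) uw).
  exact: fiber_local (eq_setIS (subsetUr D0 N) uw).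
exists (k1 + kB), wB, SB.
have [run2 HwB'] := hypersink_run A dDN (fun=> erefl) HP (introT eqP w1N) runB.
rewrite DE in run2; split.
(* Since [k1] is at least [kA + 2], the length plus two at least doubles. *)
- rewrite expnS mul2n -addnn -!addnS.
  by apply: leq_add kB_ge; exact: leq_trans kA_ge k1_ge.
- exact: run_cat (run_glue B) run2.
- move=> d; rewrite -DE in_setU /glue; case: ifP => [dN _|_].
    exact: HP.
  by rewrite orbF (HwB' : H wB); exact: sinkB.
Qed.

(** * Johnson's rule as a recency order *)

(** Each coordinate is represented by its direction away from the last vertex, available or not, so
    the rule's comparison becomes an order on all coordinates. *)
Definition less_recent (s : seq vtx) : rel 'I_n := fun c d =>
  let h e := hist s e (dir_sign (last set0 s) e) in
  let p e := prec_key e (dir_sign (last set0 s) e) in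
  (h c < h d) || (h c == h d) && (p c < p d).

Lemma prec_key_inj : injective (fun cb : 'I_n * bool => prec_key cb.1 cb.2).
Proof.
case=> [c b] [d e]; rewrite /prec_key /= => eq_key.
have [cd bE] : (c = d :> nat) /\ b = e by case: b eq_key; case: e => eq_key; lia.
by rewrite bE; congr pair; exact: val_inj.
Qed.

Lemma less_recent_priority s : priority (less_recent s).
Proof.
split=> [c d cd|d c e]; rewrite /less_recent.
  case: ltngtP => //= _; case: ltngtP => //= eq_key.
  by have [] := @prec_key_inj (c, _) (d, _) eq_key; move/eqP: cd.
case/orP=> [lt_h|/andP[/eqP eq_h lt_p]]; case/orP=> [lt_h'|/andP[/eqP eq_h' lt_p']].
- by rewrite (ltn_trans lt_h lt_h').
- by rewrite -eq_h' lt_h.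
- by rewrite eq_h lt_h'.
- by rewrite eq_h eq_h' eqxx (ltn_trans lt_p lt_p') orbT.
Qed.

Lemma hist_lt s c b : 0 < size s -> hist s c b < size s.
Proof.
move=> s_gt0; rewrite -(prednK s_gt0) ltnS /hist big_nat_cond.
elim/big_ind: _ => // [x y xs ys|i]; first by rewrite geq_max xs.
by case/andP=> /andP[_ i_lt] _; rewrite -ltnS prednK.
Qed.

Lemma hist_rcons s w c b : 0 < size s ->
  hist (rcons s w) c b =
  if ((c \in last set0 s) == b) || ((c \in w) == b) then size s else hist s c b.
Proof.
move=> s_gt0; have := hist_lt c b s_gt0.
rewrite /hist size_rcons [in LHS]big_mkcond big_nat_recr //= -big_mkcond.
rewrite [X in maxn X _](_ : _ = hist s c b).
  rewrite !nth_rcons ltnn eqxx prednK // leqnn nth_last.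
  by case: b; case: (c \in last set0 s); case: (c \in w) => //= lt_h;
    rewrite ?maxn0 ?(maxn_idPr (ltnW lt_h)).
rewrite /hist big_nat_cond [RHS]big_nat_cond; apply: eq_bigl => y.
apply: andb_id2l => /andP[_ y_lt].
by rewrite !nth_rcons y_lt (leq_ltn_trans (leq_pred _) y_lt).
Qed.

(** The new direction on [c] undoes the step just made, so its history is the number of that step,
    above all others. Any other coordinate keeps its sign and was not in the opposite state during
    the step, so its history is unchanged. *)
Lemma less_recent_rcons s c x y : 0 < size s -> x != y ->
  less_recent (rcons s (flip (last set0 s) c)) x y =
  demote c (less_recent s) x y.
Proof.
move=> s_gt0 xy; rewrite /less_recent last_rcons.
set v := last set0 s; set w := flip v c.
have hc : hist (rcons s w) c (dir_sign w c) = size s.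
  by rewrite hist_rcons // /dir_sign in_flip eqxx addbT; case: (c \in last set0 s).
have hN e : e != c -> dir_sign w e = dir_sign v e /\
    hist (rcons s w) e (dir_sign w e) = hist s e (dir_sign v e).
  move=> ec; have sE : dir_sign w e = dir_sign v e.
    by rewrite /dir_sign in_flip (negPf ec) addbF.
  split=> //; rewrite hist_rcons // sE /dir_sign in_flip (negPf ec) addbF.
  by case: (e \in v).
rewrite /demote; have [xE|xc] := eqVneq x c.
  rewrite xE hc /=; have [|_ ->] := hN y; first by rewrite eq_sym -xE.
  by have := hist_lt y (dir_sign v y) s_gt0; case: ltngtP.
have [sx ->] := hN _ xc; have [->|yc] /= := eqVneq y c.
  by rewrite hc hist_lt.
by have [sy ->] := hN _ yc; rewrite sx sy.
Qed.

Lemma run_lrb out k s w R S : 0 < size s -> lrb_run out s ->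
  (forall c d, c != d -> R c d = less_recent s c d) ->
  run out setT k (last set0 s, R) (w, S) ->
  exists p, lrb_run out p /\ size p = size s + k.
Proof.
elim: k s R => [|k IHk] s R s_gt0 s_run RE /=.
  by exists s; rewrite addn0.
case=> _ [c [/= _ vc Rc] ->] run_k.
pose s' := rcons s (flip (last set0 s) c).
have s'_run : lrb_run out s'.
  move=> i; rewrite /s' size_rcons ltnS => /andP[i_gt0 i_le]; rewrite nth_rcons.
  move: i_le; rewrite leq_eqVlt => /orP[/eqP->|i_lt].
    rewrite ltnn eqxx -cats1 take_size_cat //; exists c; split=> // d vd dc.
    by have := Rc d (in_setT d) vd dc; rewrite RE // eq_sym.
  by rewrite i_lt -cats1 takel_cat ?(ltnW i_lt) //; apply: s_run; rewrite i_gt0.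
have [|||p [p_run p_size]] := IHk s' (demote c R) _ s'_run.
- by rewrite size_rcons.
- by move=> x y xy; rewrite less_recent_rcons // /demote RE.
- by rewrite last_rcons.
by exists p; rewrite p_size size_rcons addnS.
Qed.

End LeastRecentlyFlipped.

Theorem theorem4 (n : nat) :
  0 < n -> 4 %| n ->
  exists out : {set 'I_n} -> 'I_n -> bool,
    AUSO out /\
    exists p : seq {set 'I_n},
      lrb_run out p /\ 2 ^ (n %/ 4) <= (size p).-1.
Proof.
move=> n_gt0 n4.
have m_gt0 : 0 < n %/ 4 by rewrite divn_gt0 // dvdn_leq.
have card_m : 3 * (n %/ 4) <= #|[set: 'I_n]|.
  by rewrite cardsT card_ord -[X in _ <= X](divnK n4) mulnC leq_mul2l orbT.
(* Before the first step all histories are 0, so the initial order is the tie-breaking order. *)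
have [out [autO _ [k [w [S [k_ge runk _]]]]]] :=
  long_run set0 (less_recent_priority [:: set0]) card_m.
exists out; split; first exact: auso_onT.
have run0 : lrb_run out [:: set0] by case=> [|[]].
have [p [p_run p_size]] :=
  run_lrb (s := [:: set0]) isT run0 (fun _ _ _ => erefl) runk.
exists p; split=> //; rewrite p_size add1n /=.
(* With m = n/4, the run has at least 2^(m+1) - 2 steps, which is at least 2^m because m is
   positive. *)
have: 2 <= 2 ^ (n %/ 4) by rewrite -{1}(expn1 2) leq_exp2l.
by move: k_ge; rewrite expnS; lia.
Qed.
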